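(* Let $m\ge 2$ and $n\geq 2$ be integers. There exist BS-Kœnigs nets $P\colon\mathbb{Z}^2\to\mathbb{R}\mathrm{P}^n$ such that both $P_m$ and $P_{-m}$ exist and are Laplace degenerate. Moreover, such nets are determined by their restriction to $$S=(\Sigma_{m-1}\times\mathbb{Z})\cup(\mathbb{Z}\times\Sigma_{m-1})\cup\{(m,m)\},$$ that is, if $P,P'\colon\mathbb{Z}^2\to\mathbb{R}\mathrm{P}^n$ are two BS-Kœnigs nets such that $P_m,P_{-m},P'_m,P'_{-m}$ exist and are Laplace degenerate, and $P|_S=P'|_S$, then $P=P'$.
   Context: Notation: $\Sigma_k=\{0,1,\dots,k\}$. $A\vee B$ is the join (span) of projective subspaces. Q-nets: a Q-net is a map $P\colon\mathbb{Z}^2\to\mathbb{R}\mathrm{P}^n$ such that for every unit square (face) of $\mathbb{Z}^2$ the four image points are contained in a plane. It is non-degenerate if (i) the two points at the ends of every edge are distinct, and (ii) for any three vertices of any face the corresponding points of $P$ span a plane. Laplace transforms: for a non-degenerate Q-net $P$, $\mathcal{L}_{+}P(i,j)=(P(i,j)\vee P(i,j+1))\cap(P(i+1,j)\vee P(i+1,j+1))$ and $\mathcal{L}_{-}P(i,j)=(P(i,j)\vee P(i+1,j))\cap(P(i,j+1)\vee P(i+1,j+1))$. These are again Q-nets. Put $P_0=P$, $P_k=(\mathcal{L}_+)^kP$ and $P_{-k}=(\mathcal{L}_-)^kP$ for $k\ge 0$. $P_{k}$ (resp. $P_{-k}$), $k\geq 1$, exists if all of $P_0,P_{1},\dots,P_{k-1}$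 (resp. $P_0,P_{-1},\dots,P_{-(k-1)}$) are non-degenerate. For a positive integer $k$: $P_{k}$ is Laplace degenerate if $P_{k}(i,j)$ is independent of $i$ for all $j$; $P_{-k}$ is Laplace degenerate if $P_{-k}(i,j)$ is independent of $j$ for all $i$. Laplace invariants: for four points on a projective line with representative vectors $p_1,\dots,p_4\in\mathbb{R}^2$, $\mathrm{cr}(P_1,P_2,P_3,P_4)=\frac{\det(p_1,p_2)\det(p_3,p_4)}{\det(p_2,p_3)\det(p_4,p_1)}$. For a non-degenerate Q-net $P$, $H(i,j)=\mathrm{cr}(P(i,j),P_1(i,j),P(i,j+1),P_1(i-1,j))$ and $K(i,j)=\mathrm{cr}(P(i,j),P_{-1}(i,j),P(i+1,j),P_{-1}(i,j-1))$. A BS-Kœnigs net is a non-degenerate Q-net with $H(i,j)H(i,j+1)=K(i,j+1)K(i-1,j+1)$ for all $(i,j)\in\mathbb{Z}^2$. *)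

(* Defs.v *)
From HB Require Import structures.
From mathcomp Require Import all_boot all_order all_algebra.
From mathcomp Require Import reals ring.

Set Implicit Arguments.
Unset Strict Implicit.
Unset Printing Implicit Defensive.

Import Order.TTheory GRing.Theory Num.Theory.
Local Open Scope ring_scope.

Section ProjectiveSpace.
Variables (R : realType) (n : nat).
Local Notation V := 'rV[R]_n.+1.

Record RP := ProjPoint {
  RP_space :> {vspace V};
  _ : \dim RP_space == 1%N
}.
HB.instance Definition _ := [isSub for RP_space].
HB.instance Definition _ := [Choice of RP by <:].

Implicit Types (A B C D : RP) (L : {vspace V}).

(* A projective subspace of dimension d is a vector subspace of dimension
   d + 1, so lines have [\dim] 2 and planes have [\dim] 3. *)
Definition coplanar4 A B C D : Prop :=
  exists W : {vspace V},
    \dim W = 3%N /\ [/\ (A <= W)%VS, (B <= W)%VS, (C <= W)%VS & (D <= W)%VS].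

Definition join A B : {vspace V} := (A + B)%VS.

Definition span_plane A B C : Prop := \dim (A + B + C)%VS = 3%N.

(* When [\dim L = 2] this is the tuple [vbasis L], retyped. *)
Definition line_basis L : 2.-tuple V := [tuple (vbasis L)`_0; (vbasis L)`_1].

Definition line_coord L A : 'rV[R]_2 :=
  \row_k coord (line_basis L) k (vpick A).

Definition det2 (p q : 'rV[R]_2) : R := \det (col_mx p q).

(* Meaningful when the four points lie on, and span, a line [L].  The value
   then depends neither on the basis of [L] nor on the representative
   vectors; see [cross_ratioE]. *)
Definition cross_ratio A B C D : R :=
  let L := (A + B + C + D)%VS in
  let a := line_coord L A in let b := line_coord L B in
  let c := line_coord L C in let d := line_coord L D in
  (det2 a b * det2 c d) / (det2 b c * det2 d a).

End ProjectiveSpace.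

Section QNets.
Variables (R : realType) (n : nat).

Definition net := int -> int -> RP R n.

Implicit Types (P : net) (i j : int).

Definition qnet P : Prop := forall i j,
  coplanar4 (P i j) (P (i + 1) j) (P i (j + 1)) (P (i + 1) (j + 1)).

Definition nondegenerate P : Prop :=
  [/\ qnet P,
      forall i j, P i j <> P (i + 1) j /\ P i j <> P i (j + 1)
    & forall i j,
      [/\ span_plane (P i j) (P (i + 1) j) (P i (j + 1)),
          span_plane (P i j) (P (i + 1) j) (P (i + 1) (j + 1)),
          span_plane (P i j) (P i (j + 1)) (P (i + 1) (j + 1))
        & span_plane (P (i + 1) j) (P i (j + 1)) (P (i + 1) (j + 1))]].

(* The two lines meet in a point when [P] is non-degenerate
   ([laplace_plusE], [laplace_minusE]); the default value [P i j] is used only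
   when their intersection is not a point. *)
Definition laplace_plus P : net := fun i j =>
  insubd (P i j)
    (capv (join (P i j) (P i (j + 1))) (join (P (i + 1) j) (P (i + 1) (j + 1)))).

Definition laplace_minus P : net := fun i j =>
  insubd (P i j)
    (capv (join (P i j) (P (i + 1) j)) (join (P i (j + 1)) (P (i + 1) (j + 1)))).

Definition lap_plus (k : nat) P : net := iter k laplace_plus P.
Definition lap_minus (k : nat) P : net := iter k laplace_minus P.

Definition lap_plus_exists (k : nat) P : Prop :=
  forall l : nat, (l < k)%N -> nondegenerate (lap_plus l P).
Definition lap_minus_exists (k : nat) P : Prop :=
  forall l : nat, (l < k)%N -> nondegenerate (lap_minus l P).

Definition laplace_degenerate_plus (k : nat) P : Prop :=
  forall j i i', lap_plus k P i j = lap_plus k P i' j.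
Definition laplace_degenerate_minus (k : nat) P : Prop :=
  forall i j j', lap_minus k P i j = lap_minus k P i j'.

Definition invH P i j : R :=
  cross_ratio (P i j) (lap_plus 1%N P i j) (P i (j + 1)) (lap_plus 1%N P (i - 1) j).
Definition invK P i j : R :=
  cross_ratio (P i j) (lap_minus 1%N P i j) (P (i + 1) j) (lap_minus 1%N P i (j - 1)).

Definition bs_koenigs P : Prop :=
  nondegenerate P /\
  forall i j, invH P i j * invH P i (j + 1)
              = invK P i (j + 1) * invK P (i - 1) (j + 1).

End QNets.

Definition Sigma (k : nat) : pred int := [pred i | 0 <= i <= k%:Z].

Definition initial_set (m : nat) (i j : int) : bool :=
  [|| i \in Sigma m.-1, j \in Sigma m.-1 | (i == m%:Z) && (j == m%:Z)].

Section Facts.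
Variables (R : realType) (n : nat).
Local Notation V := 'rV[R]_n.+1.

Lemma dim_meet_lines (A B C D : RP R n) :
  coplanar4 A B C D -> span_plane A B C -> \dim (C + D)%VS = 2%N ->
  \dim (A + B)%VS = 2%N -> \dim ((A + B) :&: (C + D))%VS == 1%N.
Proof.
move=> [W [dW [sA sB sC sD]]] dABC dCD dAB.
have dU : \dim (A + B + (C + D))%VS = 3%N.
  apply/eqP; rewrite eqn_leq -{1}dW dimvS ?subv_add ?sA ?sB ?sC ?sD //=.
  by rewrite -dABC addvA dimvS // addvSl.
by have := dimv_sum_cap (A + B)%VS (C + D)%VS; rewrite dU dAB dCD => /eqP; rewrite (eqn_add2l 3 _ 1).
Qed.

Lemma dim_RP (A : RP R n) : \dim A = 1%N.
Proof. by case: A => A /= /eqP. Qed.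

Lemma dim_join (A B C : RP R n) : span_plane A B C -> \dim (A + B)%VS = 2%N.
Proof.
rewrite /span_plane => d3; apply/eqP; rewrite eqn_leq.
have [+ _] := dimv_add_leqif (A + B)%VS C.
have [+ _] := dimv_add_leqif A B.
by rewrite d3 !dim_RP => -> /=; rewrite addn1 ltnS.
Qed.

Lemma laplace_plusE (P : net R n) i j : nondegenerate P ->
  laplace_plus P i j =
    (capv (join (P i j) (P i (j + 1))) (join (P (i + 1) j) (P (i + 1) (j + 1)))) :> {vspace V}.
Proof.
case=> [Q _ /(_ i j) [s1 s2 s3 s4]]; rewrite [LHS]insubdK //.
apply: dim_meet_lines.
- have [W [dW [*]]] := Q i j; by exists W.
- by rewrite /span_plane -addvA [X in (_ + X)%VS]addvC addvA.
- by apply: (@dim_join _ _ (P i j)); rewrite /span_plane addvC addvA.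
- by apply: (@dim_join _ _ (P (i + 1) (j + 1))).
Qed.

Lemma laplace_minusE (P : net R n) i j : nondegenerate P ->
  laplace_minus P i j =
    (capv (join (P i j) (P (i + 1) j)) (join (P i (j + 1)) (P (i + 1) (j + 1)))) :> {vspace V}.
Proof.
case=> [Q _ /(_ i j) [s1 s2 s3 s4]]; rewrite [LHS]insubdK //.
apply: dim_meet_lines; [exact: Q | exact: s1 | | exact: (dim_join s1)].
by apply: (@dim_join _ _ (P i j)); rewrite /span_plane addvC addvA.
Qed.

Lemma cross_ratioE (A B C D : RP R n) (e : 2.-tuple V) (a b c d : V) :
  basis_of (A + B + C + D)%VS e ->
  <[a]>%VS = A -> <[b]>%VS = B -> <[c]>%VS = C -> <[d]>%VS = D ->
  let x (v : V) := \row_k coord e k v in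
  cross_ratio A B C D =
    (det2 (x a) (x b) * det2 (x c) (x d)) / (det2 (x b) (x c) * det2 (x d) (x a)).
Proof.
move=> eL aA bB cC dD x; set L := (A + B + C + D)%VS in eL *.
have dL : \dim L = 2%N by rewrite -(size_basis eL).
set f := line_basis L.
have fL : basis_of L f.
  suff -> : f = vbasis L :> seq V by apply: vbasisP.
  apply: (@eq_from_nth _ 0); first by rewrite size_tuple size_tuple dL.
  by move=> [|[|k]].
pose M : 'M[R]_2 := \matrix_(k, l) coord f l e`_k.
pose N : 'M[R]_2 := \matrix_(k, l) coord e l f`_k.
have MN : M *m N = 1%:M.
  apply/matrixP => k l; rewrite !mxE.
  under eq_bigr do rewrite !mxE.
  transitivity (coord e l (\sum_j coord f j e`_k *: f`_j)).
    by rewrite linear_sum /=; apply: eq_bigr => j _; rewrite linearZ.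
  rewrite -coord_span ?(span_basis fL) ?coord_free ?(basis_free eL) //.
  by apply: (basis_mem eL); rewrite mem_nth // size_tuple.
have dM : \det M != 0.
  by apply/eqP => M0; move: (congr1 determinant MN); rewrite det_mulmx M0 mul0r det1;
    move/eqP; rewrite eq_sym oner_eq0.
have lc (p : RP R n) (v : V) : <[v]>%VS = p -> (p <= L)%VS ->
    exists2 t, t != 0 & line_coord L p = t *: (x v *m M).
  move=> vp pL.
  have : vpick p \in <[v]>%VS by rewrite vp memv_pick.
  case/vlineP => t pt; exists t.
    apply/eqP => t0; move: pt; rewrite t0 scale0r => /eqP; rewrite vpick0 => /eqP p0.
    by case: (p) p0 => /= U dU U0; move: dU; rewrite U0 dimv0.
  apply/rowP => l; rewrite !mxE pt linearZ /=; congr (_ * _).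
  have vL : v \in <<e>>%VS by rewrite (span_basis eL) (subvP pL) // -vp memv_line.
  rewrite {1}(coord_span vL) linear_sum /=; apply: eq_bigr => j _.
  by rewrite linearZ !mxE.
have det2Z (s t : R) (p q : 'rV[R]_2) :
    det2 (s *: (p *m M)) (t *: (q *m M)) = s * t * (\det M * det2 p q).
  rewrite /det2; have -> : col_mx (s *: (p *m M)) (t *: (q *m M)) =
    block_mx s%:M 0 0 t%:M *m (col_mx p q *m M : 'M_(1 + 1, 2)).
    by rewrite (mul_col_mx p q M) mul_block_col !mul_scalar_mx !mul0mx addr0 add0r.
  by rewrite !det_mulmx det_ublock !det_scalar1 [_ * \det M]mulrC.
have sA : (A <= L)%VS by rewrite /L -!addvA addvSl.
have sB : (B <= L)%VS by rewrite /L -!addvA (addvC B) !addvA addvSr.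
have sC : (C <= L)%VS by rewrite /L -addvA (addvC C) addvA addvSr.
have sD : (D <= L)%VS by rewrite /L addvSr.
have [ta ta0 ea] := lc _ _ aA sA; have [tb tb0 eb] := lc _ _ bB sB.
have [tc tc0 ec] := lc _ _ cC sC; have [td td0 ed] := lc _ _ dD sD.
rewrite /cross_ratio -/L ea eb ec ed !det2Z.
set p := det2 (x a) _; set q := det2 _ (x d); set r := det2 (x b) _.
set s := det2 (x d) _.
have -> : tb * tc * (\det M * r) * (td * ta * (\det M * s))
   = (ta * tb * tc * td * \det M ^+ 2) * (r * s) by rewrite expr2; ring.
have -> : ta * tb * (\det M * p) * (tc * td * (\det M * q))
   = (ta * tb * tc * td * \det M ^+ 2) * (p * q) by rewrite expr2; ring.
by rewrite -mulf_div divff ?mul1r // !mulf_neq0 // expf_neq0.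
Qed.

End Facts.

(* Main.v *)
(* Existence. With rising factorials (x)_a = x (x + 1) ... (x + a - 1), put
   P_(a,b)(i, j) = [1 / ((p + i - k)_a (q + j - k)_b)]_k, where p, q and p - q
   are not integers.  On a face all points and intersection points are, up to a
   common factor, polynomials of degree at most 2 in k with explicit linear
   factors, whence L_+ P_(a,b) = P_(a-1,b+1) with p replaced by p + 1, and
   symmetrically for L_-.  So P_(m,m) reaches P_(0,2m) and P_(2m,0) after m
   steps, and these are Laplace degenerate.  With d = p - q + i - j one gets
   H = h(d) and K = h(-d), where h(d) = (m - d)(m - 1 + d) / (d (1 - d)), and
   h(1 - d) = h(d) gives the Koenigs condition.

   Uniqueness. In a square of m + 1 by m + 1 vertices, assume that all points
   but the upper right one are known, and also the point P_m of the square.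
   Going down from k = m to k = 2, the unknown corner of P_(k-1) is the
   intersection of a known edge line of P_(k-2) with the line joining the known
   P_k to a known neighbour; non-degeneracy of P_(k-1) makes these lines
   distinct.  Once the corner of P_1 is known, the Koenigs condition determines
   that of P_(-1), and the two together determine the corner of P.  Laplace
   degeneracy carries P_m along strips of m + 1 rows, so that, up to reflections
   and transposition, every row and column is reached from the initial set. *)
Require Import Defs.
From mathcomp Require Import all_boot all_order all_algebra.
From mathcomp Require Import reals boolp ring lra zify.
(* [nondegenerate] must denote the predicate on nets, not the one on forms. *)
Import Defs.
Import Order.TTheory GRing.Theory Num.Theory.
Local Open Scope ring_scope.

Set Implicit Arguments.
Unset Strict Implicit.
Unset Printing Implicit Defensive.

(** * Points and lines of projective space *)

Section Geometry.
Variables (R : realType) (n : nat).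
Local Notation V := 'rV[R]_n.+1.
Implicit Types (A B C D X Y : RP R n) (L : {vspace V}).

Lemma addvAC : right_commutative (@addv R V).
Proof. by move=> U W Z; rewrite -!addvA (addvC W). Qed.

Lemma RP_inj A B : A = B :> {vspace V} -> A = B.
Proof. exact: val_inj. Qed.

Lemma RP_sub_eq A B : (A <= B)%VS -> A = B.
Proof. by move=> sAB; apply/RP_inj/eqP; rewrite eqEdim sAB !dim_RP. Qed.

Lemma RP_vec A : exists2 v : V, v != 0 & <[v]>%VS = A.
Proof.
have A0 : vpick A != 0.
  by rewrite vpick0; apply/eqP => A0; have := dim_RP A; rewrite A0 dimv0.
exists (vpick A) => //; apply/eqP; rewrite eqEdim dim_vline A0 dim_RP.
by rewrite -memvE memv_pick.
Qed.

Lemma dim_join_neq A B : A <> B -> \dim (A + B)%VS = 2%N.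
Proof.
move=> nAB; have := dimv_sum_cap A B; rewrite !dim_RP.
suff -> : \dim (A :&: B)%VS = 0%N by rewrite addn0.
apply/eqP; rewrite -leqn0 leqNgt; apply/negP => lt0.
apply: nAB; apply: RP_sub_eq; have : (A :&: B == A)%VS.
  by rewrite eqEdim capvSl dim_RP.
by move/eqP <-; exact: capvSr.
Qed.

Lemma join_eq A B L : A <> B -> \dim L = 2%N -> (A <= L)%VS -> (B <= L)%VS ->
  (A + B)%VS = L.
Proof.
move=> nAB dL sA sB; apply/eqP.
by rewrite eqEdim subv_add sA sB dL dim_join_neq.
Qed.

Lemma join_exchange A B Y : A <> B -> Y <> A -> (Y <= A + B)%VS ->
  (A + Y)%VS = (A + B)%VS.
Proof.
move=> nAB nYA sY; apply: join_eq; rewrite ?addvSl //; first exact: nesym.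
exact: dim_join_neq.
Qed.

Lemma lines_meet_uniq L1 L2 X Y : \dim L1 = 2%N -> \dim L2 = 2%N ->
  (X <= L1)%VS -> (X <= L2)%VS -> (Y <= L1)%VS -> (Y <= L2)%VS ->
  L1 <> L2 -> X = Y.
Proof.
move=> d1 d2 x1 x2 y1 y2 n12; apply: contrapT => nXY; apply: n12.
by rewrite -(join_eq nXY d1) // -(join_eq nXY d2).
Qed.

Lemma span_plane_not_line A B C L : span_plane A B C -> \dim L = 2%N ->
  (A <= L)%VS -> (B <= L)%VS -> (C <= L)%VS -> False.
Proof.
move=> s3 d2 sA sB sC; have : (A + B + C <= L)%VS by rewrite !subv_add sA sB.
by move/dimvS; rewrite s3 d2.
Qed.



Lemma det2E (p q : 'rV[R]_2) : det2 p q = p 0 0 * q 0 1 - p 0 1 * q 0 0.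
Proof.
have det22 (M : 'M[R]_2) : \det M = M 0 0 * M 1 1 - M 0 1 * M 1 0.
  rewrite (expand_det_row _ 0) !big_ord_recl big_ord0 /cofactor !det_mx11 !mxE.
  rewrite expr0 expr1 addr0 mul1r mulN1r mulrN.
  by congr (_ * M _ _ - M _ _ * M _ _); apply/val_inj.
have Eu j : col_mx p q 0 j = p 0 j.
  by rewrite -(col_mxEu p q); congr (col_mx p q _ _); apply/val_inj.
have Ed j : col_mx p q 1 j = q 0 j.
  by rewrite -(col_mxEd p q); congr (col_mx p q _ _); apply/val_inj.
by rewrite /det2 det22 !Eu !Ed.
Qed.

Lemma det2C (p q : 'rV[R]_2) : det2 p q = - det2 q p.
Proof. by rewrite !det2E; ring. Qed.

(** Reflecting a net in i swaps the two points of P_1 on an edge line, the second and fourth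
    arguments in [invH]. In [invK] it swaps the first and third, the ends of the edge. *)
Lemma cross_ratio_swap24 A B C D :
  cross_ratio A D C B = (cross_ratio A B C D)^-1.
Proof.
rewrite /cross_ratio.
have -> : (A + D + C + B = A + B + C + D)%VS.
  by rewrite (addvAC (A + D)%VS C) (addvAC A D) (addvAC _ D C).
set L := (A + B + C + D)%VS; set a := line_coord L A; set b := line_coord L B.
set c := line_coord L C; set d := line_coord L D.
rewrite invf_div (det2C d c) (det2C b a) (det2C c b) (det2C a d) !mulrNN.
by rewrite (mulrC (det2 d a)) (mulrC (det2 c d)).
Qed.

Lemma cross_ratio_swap13 A B C D :
  cross_ratio C B A D = (cross_ratio A B C D)^-1.
Proof.
rewrite /cross_ratio.
have -> : (C + B + A + D = A + B + C + D)%VS.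
  by rewrite (addvC (C + B)%VS A) (addvC C B) addvA.
set L := (A + B + C + D)%VS; set a := line_coord L A; set b := line_coord L B.
set c := line_coord L C; set d := line_coord L D.
by rewrite invf_div (det2C c b) (det2C a d) (det2C b a) (det2C d c) !mulrNN.
Qed.

Lemma neq_free A B (a b : V) : A <> B -> <[a]>%VS = A -> <[b]>%VS = B ->
  free [:: a; b].
Proof.
move=> nAB aA bB; rewrite /free span_cons span_seq1 aA bB.
by rewrite (dim_join_neq nAB).
Qed.

(** In the basis (a, b) of the line the four determinants are y1, -d0, y0 and -d1. *)
Lemma cross_ratio_coords A B Y D (a b : V) (y0 y1 d0 d1 : R) : A <> B ->
  <[a]>%VS = A -> <[b]>%VS = B ->
  <[y0 *: a + y1 *: b]>%VS = Y -> <[d0 *: a + d1 *: b]>%VS = D ->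
  cross_ratio A Y B D = (y1 * d0) / (y0 * d1).
Proof.
move=> nAB aA bB yY dD; set e : 2.-tuple V := [tuple a; b].
have fe : free e by apply: neq_free aA bB.
have ceq k (c0 c1 : R) : coord e k (c0 *: a + c1 *: b) = if k == 0 then c0 else c1.
  rewrite linearD !linearZ /= -[a]/(e`_((0 : 'I_2)%R)) -[b]/(e`_((1 : 'I_2)%R)).
  rewrite !coord_free //.
  by case: k => [[|[|k]] kk] //=; rewrite !(mulr1, mulr0) ?addr0 ?add0r.
have in_ab c0 c1 : c0 *: a + c1 *: b \in (A + B)%VS.
  by apply: memv_add; apply: memvZ; rewrite -(aA, bB) memv_line.
have bas : basis_of (A + Y + B + D)%VS e.
  rewrite basisEfree fe /= span_cons span_seq1 aA bB.
  have -> /= : (A + B <= A + Y + B + D)%VS.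
    by rewrite (addvAC A Y) -(addvA (A + B)%VS Y D) addvSl.
  rewrite -(dim_join_neq nAB); apply: dimvS.
  by rewrite !subv_add addvSl addvSr -yY -dD -!memvE !in_ab.
have ca k : coord e k a = if k == 0 then 1 else 0.
  by rewrite -ceq scale1r scale0r addr0.
have cb k : coord e k b = if k == 0 then 0 else 1.
  by rewrite -ceq scale1r scale0r add0r.
rewrite (cross_ratioE bas aA yY bB dD) !det2E !mxE !ceq !ca !cb /=.
rewrite !(mul0r, mul1r, mulr0, mulr1, subr0, sub0r).
by rewrite !mulrN invrN mulrNN.
Qed.

Lemma join_coords A B X (a b : V) : <[a]>%VS = A -> <[b]>%VS = B ->
  X <> A -> X <> B -> (X <= A + B)%VS ->
  exists x0 x1 : R, [/\ x0 != 0, x1 != 0 & <[x0 *: a + x1 *: b]>%VS = X].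
Proof.
move=> aA bB nXA nXB sX; have [x x0 xX] := RP_vec X.
have : x \in (A + B)%VS by rewrite (subvP sX) // -xX memv_line.
rewrite -aA -bB; case/memv_addP => _ /vlineP[c0 ->] [_ /vlineP[c1 ->] xE].
exists c0, c1; rewrite -xE; split=> //; apply/eqP => c00.
  apply: nXB; apply: RP_sub_eq; rewrite -xX -memvE xE c00 scale0r add0r.
  by rewrite -bB memvZ ?memv_line.
apply: nXA; apply: RP_sub_eq; rewrite -xX -memvE xE c00 scale0r addr0.
by rewrite -aA memvZ ?memv_line.
Qed.

Lemma cross_ratio_neq0 A B D Y : A <> B -> D <> A -> D <> B ->
  (D <= A + B)%VS -> Y <> A -> Y <> B -> (Y <= A + B)%VS ->
  cross_ratio A Y B D != 0.
Proof.
move=> nAB nDA nDB sD nYA nYB sY.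
have [a _ aA] := RP_vec A; have [b _ bB] := RP_vec B.
have [d0 [d1 [d00 d10 dD]]] := join_coords aA bB nDA nDB sD.
have [y0 [y1 [y00 y10 yY]]] := join_coords aA bB nYA nYB sY.
rewrite (cross_ratio_coords nAB aA bB yY dD).
by rewrite mulf_neq0 ?invr_neq0 // mulf_neq0.
Qed.

(** Cancelling d0 / d1 leaves y1 / y0 = z1 / z0, so the two representative vectors are proportional.
    This recovers a point of P_(-1) from a value of K. *)
Lemma cross_ratio_inj A B D Y Y' : A <> B -> D <> A -> D <> B ->
  (D <= A + B)%VS ->
  Y <> A -> Y <> B -> (Y <= A + B)%VS ->
  Y' <> A -> Y' <> B -> (Y' <= A + B)%VS ->
  cross_ratio A Y B D = cross_ratio A Y' B D -> Y = Y'.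
Proof.
move=> nAB nDA nDB sD nYA nYB sY nYA' nYB' sY'.
have [a _ aA] := RP_vec A; have [b _ bB] := RP_vec B.
have [d0 [d1 [d00 d10 dD]]] := join_coords aA bB nDA nDB sD.
have [y0 [y1 [y00 y10 yY]]] := join_coords aA bB nYA nYB sY.
have [z0 [z1 [z00 z10 zY]]] := join_coords aA bB nYA' nYB' sY'.
rewrite (cross_ratio_coords nAB aA bB yY dD) (cross_ratio_coords nAB aA bB zY dD) => E.
have {}E : y1 * z0 = z1 * y0.
  move/eqP: E; rewrite eqr_div ?mulf_neq0 // => /eqP E.
  apply: (mulIf (mulf_neq0 d00 d10)).
  by transitivity (y1 * d0 * (z0 * d1)); [ring | rewrite E; ring].
apply: RP_sub_eq; rewrite -yY -zY -memvE; apply/vlineP; exists (y0 / z0).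
rewrite scalerDr !scalerA divfK //; congr (_ + _ *: _).
by apply: (mulIf z00); rewrite E; field.
Qed.

End Geometry.

(** * Laplace transforms and symmetries of nets *)

Section Laplace.
Variables (R : realType) (n : nat).
Implicit Types (P M N : net R n) (i j : int).

Lemma nondegenerate_row P : nondegenerate P -> forall i j, P i j <> P (i + 1) j.
Proof. by case=> _ e _ i j; case: (e i j). Qed.

Lemma nondegenerate_col P : nondegenerate P -> forall i j, P i j <> P i (j + 1).
Proof. by case=> _ e _ i j; case: (e i j). Qed.

Lemma laplace_plus_sub P i j : nondegenerate P ->
  (laplace_plus P i j <= P i j + P i (j + 1)%R)%VS /\
  (laplace_plus P i j <= P (i + 1)%R j + P (i + 1)%R (j + 1)%R)%VS.
Proof. by move=> nP; rewrite laplace_plusE // capvSl capvSr. Qed.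

Lemma laplace_plus_uniq P i j (Z : RP R n) : nondegenerate P ->
  (Z <= P i j + P i (j + 1)%R)%VS ->
  (Z <= P (i + 1)%R j + P (i + 1)%R (j + 1)%R)%VS -> laplace_plus P i j = Z.
Proof.
move=> nP s1 s2; apply/esym; apply: RP_sub_eq.
by rewrite laplace_plusE // subv_cap s1.
Qed.

(** A vertex equal to the meeting point would lie on the opposite edge line, making three vertices
    of the face collinear. *)
Lemma laplace_plus_neq P i j : nondegenerate P ->
  [/\ laplace_plus P i j <> P i j, laplace_plus P i j <> P i (j + 1),
      laplace_plus P i j <> P (i + 1) j
    & laplace_plus P i j <> P (i + 1) (j + 1)].
Proof.
move=> nP; have [s1 s2] := laplace_plus_sub i j nP.
have d1 := dim_join_neq (@nondegenerate_col P nP i j).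
have d2 := dim_join_neq (@nondegenerate_col P nP (i + 1) j).
case: nP => _ _ /(_ i j)[t1 t2 t3 t4].
split=> E; rewrite E in s1 s2.
- by apply: (span_plane_not_line t2 d2); rewrite ?addvSl ?addvSr.
- by apply: (span_plane_not_line t4 d2); rewrite ?addvSl ?addvSr.
- by apply: (span_plane_not_line t1 d1); rewrite ?addvSl ?addvSr.
- by apply: (span_plane_not_line t3 d1); rewrite ?addvSl ?addvSr.
Qed.

(** P_k at a vertex only sees the square of k + 1 by k + 1 vertices above and to the right of it.
    Non-degeneracy is not assumed, because the transform is a total function of the four vertices of
    a face. *)
Lemma lap_plus_ext k P P' i j :
  (forall s t : nat, (s <= k)%N -> (t <= k)%N ->
     P (i + s%:Z) (j + t%:Z) = P' (i + s%:Z) (j + t%:Z)) ->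
  lap_plus k P i j = lap_plus k P' i j.
Proof.
elim: k i j => [|k IHk] i j eqP.
  by have := eqP 0%N 0%N isT isT; rewrite !addr0.
have eqk (a b : nat) : (a <= 1)%N -> (b <= 1)%N ->
    lap_plus k P (i + a%:Z) (j + b%:Z) = lap_plus k P' (i + a%:Z) (j + b%:Z).
  by move=> a1 b1; apply: IHk => s t sk tk; rewrite -!addrA -!PoszD; apply: eqP; lia.
have := eqk 0%N 0%N isT isT; have := eqk 1%N 0%N isT isT.
have := eqk 0%N 1%N isT isT; have := eqk 1%N 1%N isT isT; rewrite !addr0.
by rewrite /lap_plus !iterS /laplace_plus => -> -> -> ->.
Qed.

(** Exchanges L_+ with L_- and H with K, up to conversion, so statements on the minus side follow
    from those on the plus side. *)
Definition transpose_net P : net R n := fun i j => P j i.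

Lemma nondegenerate_transpose P : nondegenerate P -> nondegenerate (transpose_net P).
Proof.
have sC (A B C : RP R n) : span_plane A B C -> span_plane B A C.
  by rewrite /span_plane (addvC A).
have sR (A B C : RP R n) : span_plane A B C -> span_plane A C B.
  by rewrite /span_plane addvAC.
case=> Q e s; split.
- by move=> i j; have [W [dW [*]]] := Q j i; exists W.
- by move=> i j; have [] := e j i.
- by move=> i j; have [s1 s2 s3 s4] := s j i; split=> //; [exact: sR | exact: sC].
Qed.

Lemma lap_minus_transpose k P :
  lap_minus k (transpose_net P) = transpose_net (lap_plus k P).
Proof. by elim: k => // k IHk; rewrite /lap_minus iterS -/(lap_minus _ _) IHk. Qed.

Lemma lap_plus_transpose k P :
  lap_plus k (transpose_net P) = transpose_net (lap_minus k P).
Proof. by elim: k => // k IHk; rewrite /lap_plus iterS -/(lap_plus _ _) IHk. Qed.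

Lemma invK_transpose P i j : invK P i j = invH (transpose_net P) j i.
Proof. by []. Qed.

Lemma laplace_minus_sub P i j : nondegenerate P ->
  (laplace_minus P i j <= P i j + P (i + 1)%R j)%VS /\
  (laplace_minus P i j <= P i (j + 1)%R + P (i + 1)%R (j + 1)%R)%VS.
Proof. by move/nondegenerate_transpose; apply: laplace_plus_sub. Qed.

Lemma laplace_minus_uniq P i j (Z : RP R n) : nondegenerate P ->
  (Z <= P i j + P (i + 1)%R j)%VS ->
  (Z <= P i (j + 1)%R + P (i + 1)%R (j + 1)%R)%VS -> laplace_minus P i j = Z.
Proof. by move/nondegenerate_transpose; apply: laplace_plus_uniq. Qed.

Lemma laplace_minus_neq P i j : nondegenerate P ->
  [/\ laplace_minus P i j <> P i j, laplace_minus P i j <> P (i + 1) j,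
      laplace_minus P i j <> P i (j + 1)
    & laplace_minus P i j <> P (i + 1) (j + 1)].
Proof. by move/nondegenerate_transpose/laplace_plus_neq => /(_ j i). Qed.

Definition reflect_net (c : int) P : net R n := fun i j => P (c - i) j.

Lemma nondegenerate_reflect c P : nondegenerate P -> nondegenerate (reflect_net c P).
Proof.
have sC (A B C : RP R n) : span_plane A B C -> span_plane B A C.
  by rewrite /span_plane (addvC A).
have e1 i : c - i = c - (i + 1) + 1 by lia.
case=> Q e s; split=> i j; rewrite /reflect_net (e1 i).
- have [W [dW [*]]] := Q (c - (i + 1)) j; by exists W.
- split; last by case: (e (c - (i + 1) + 1) j).
  by apply/nesym; case: (e (c - (i + 1)) j).
- have [s1 s2 s3 s4] := s (c - (i + 1)) j.
  split.
  + exact: sC.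
  + exact: sC.
  + by rewrite /span_plane addvAC.
  + by rewrite /span_plane addvAC.
Qed.

(** The face at i is reflected to the face whose left column is c - 1 - i, so every Laplace step
    lowers the reflection constant by one. *)
Lemma laplace_plus_reflect c P : nondegenerate P ->
  laplace_plus (reflect_net c P) = reflect_net (c - 1) (laplace_plus P).
Proof.
move=> nP; apply/funext => i; apply/funext => j.
have e1 : c - (i + 1) = c - 1 - i by lia.
have e2 : c - i = c - 1 - i + 1 by lia.
apply: laplace_plus_uniq; first exact: nondegenerate_reflect.
  by rewrite /reflect_net e2; case: (laplace_plus_sub (c - 1 - i) j nP).
by rewrite /reflect_net e1; case: (laplace_plus_sub (c - 1 - i) j nP).
Qed.

Lemma laplace_minus_reflect c P : nondegenerate P ->
  laplace_minus (reflect_net c P) = reflect_net (c - 1) (laplace_minus P).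
Proof.
move=> nP; apply/funext => i; apply/funext => j.
have e1 : c - (i + 1) = c - 1 - i by lia.
have e2 : c - i = c - 1 - i + 1 by lia.
apply: laplace_minus_uniq; first exact: nondegenerate_reflect.
  by rewrite /reflect_net e1 e2 addvC; case: (laplace_minus_sub (c - 1 - i) j nP).
by rewrite /reflect_net e1 e2 addvC; case: (laplace_minus_sub (c - 1 - i) j nP).
Qed.

Lemma lap_plus_reflect k c P : lap_plus_exists k P ->
  lap_plus k (reflect_net c P) = reflect_net (c - k%:Z) (lap_plus k P).
Proof.
elim: k => [|k IHk] exP; first by rewrite subr0.
rewrite /lap_plus !iterS -!/(lap_plus _ _) IHk => [|l lk]; last exact: exP _ (ltnW lk).
have -> : c - k.+1%:Z = c - k%:Z - 1 by lia.
by rewrite laplace_plus_reflect //; exact: exP.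
Qed.

Lemma lap_minus_reflect k c P : lap_minus_exists k P ->
  lap_minus k (reflect_net c P) = reflect_net (c - k%:Z) (lap_minus k P).
Proof.
elim: k => [|k IHk] exP; first by rewrite subr0.
rewrite /lap_minus !iterS -!/(lap_minus _ _) IHk => [|l lk]; last exact: exP _ (ltnW lk).
have -> : c - k.+1%:Z = c - k%:Z - 1 by lia.
by rewrite laplace_minus_reflect //; exact: exP.
Qed.

Lemma invH_reflect c P i j : nondegenerate P ->
  invH (reflect_net c P) i j = (invH P (c - i) j)^-1.
Proof.
move=> nP; rewrite /invH /= laplace_plus_reflect // cross_ratio_swap24.
rewrite /reflect_net; have -> : c - 1 - (i - 1) = c - i by lia.
by have -> : c - 1 - i = c - i - 1 by lia.
Qed.

Lemma invK_reflect c P i j : nondegenerate P ->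
  invK (reflect_net c P) i j = (invK P (c - 1 - i) j)^-1.
Proof.
move=> nP; rewrite /invK /= laplace_minus_reflect // cross_ratio_swap13 /reflect_net.
have -> : c - (i + 1) = c - 1 - i by lia.
by have -> : c - i = c - 1 - i + 1 by lia.
Qed.

End Laplace.

(** * Symmetries of Laplace degenerate BS-Kœnigs nets *)

Section DegenerateKoenigs.
Variables (R : realType) (n : nat).
Implicit Types (P : net R n) (i j : int).

Definition degenerate_koenigs m P : Prop :=
  [/\ bs_koenigs P, lap_plus_exists m P, lap_minus_exists m P,
      laplace_degenerate_plus m P & laplace_degenerate_minus m P].

Lemma degenerate_koenigs_transpose m P :
  degenerate_koenigs m P -> degenerate_koenigs m (transpose_net P).
Proof.
case=> -[nP bsP] exp exm dgp dgm; split.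
- split=> [|i j]; first exact: nondegenerate_transpose.
  (* Transposition exchanges the two sides of the Kœnigs condition and moves its base vertex. *)
  have := bsP (j + 1) (i - 1); rewrite subrK !invK_transpose addrK => E.
  by rewrite [RHS]mulrC [LHS]mulrC; exact/esym.
- by move=> l lm; rewrite lap_plus_transpose; apply/nondegenerate_transpose/exm.
- by move=> l lm; rewrite lap_minus_transpose; apply/nondegenerate_transpose/exp.
- by move=> j i i'; rewrite lap_plus_transpose; apply: dgm.
- by move=> i j j'; rewrite lap_minus_transpose; apply: dgp.
Qed.

Lemma degenerate_koenigs_reflect c m P :
  degenerate_koenigs m P -> degenerate_koenigs m (reflect_net c P).
Proof.
case=> -[nP bsP] exp exm dgp dgm.
have exp' l : (l <= m)%N -> lap_plus_exists l P.
  by move=> lm k kl; exact: exp _ (leq_trans kl lm).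
have exm' l : (l <= m)%N -> lap_minus_exists l P.
  by move=> lm k kl; exact: exm _ (leq_trans kl lm).
split.
- split=> [|i j]; first exact: nondegenerate_reflect.
  (* All four invariants are inverted and the two factors K trade places. *)
  rewrite !invH_reflect // !invK_reflect // -!invfM bsP [in RHS]mulrC.
  have -> : c - 1 - (i - 1) = c - i by lia.
  by have -> : c - 1 - i = c - i - 1 by lia.
- move=> l lm; rewrite lap_plus_reflect; last exact/exp'/ltnW.
  exact/nondegenerate_reflect/exp.
- move=> l lm; rewrite lap_minus_reflect; last exact/exm'/ltnW.
  exact/nondegenerate_reflect/exm.
- by move=> j i i'; rewrite lap_plus_reflect //; apply: dgp.
- by move=> i j j'; rewrite lap_minus_reflect //; apply: dgm.
Qed.

End DegenerateKoenigs.

(** * Uniqueness *)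

Section Uniqueness.
Variables (R : realType) (n : nat).
Implicit Types (P M N : net R n) (i j : int).

(** One step of the descent, with [M], [N] and [laplace_plus N] three consecutive transforms. The
    corner of [N] is the meeting point of [L1], an edge line of [M], and [L2], an edge line of [N]
    known through the next transform. *)
Lemma laplace_plus_corner M M' i j (N := laplace_plus M) (N' := laplace_plus M') :
  nondegenerate M -> nondegenerate M' -> nondegenerate N -> nondegenerate N' ->
  M (i + 1) (j + 1) = M' (i + 1) (j + 1) ->
  M (i + 1) (j + 1 + 1) = M' (i + 1) (j + 1 + 1) ->
  N (i + 1) j = N' (i + 1) j -> laplace_plus N i j = laplace_plus N' i j ->
  N (i + 1) (j + 1) = N' (i + 1) (j + 1).
Proof.
move=> nM nM' nN nN' e1 e2 eN eL.
pose L1 := (M (i + 1)%R (j + 1)%R + M (i + 1)%R (j + 1 + 1)%R)%VS.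
pose L2 := (N (i + 1)%R j + laplace_plus N i j)%VS.
have d1 : \dim L1 = 2%N by apply: dim_join_neq; apply: nondegenerate_col.
have EL2 Q : nondegenerate Q -> (Q (i + 1)%R j + laplace_plus Q i j =
    Q (i + 1)%R j + Q (i + 1)%R (j + 1)%R)%VS.
  move=> nQ; apply: join_exchange.
  - exact: nondegenerate_col.
  - by case: (laplace_plus_neq i j nQ).
  - by case: (laplace_plus_sub i j nQ).
have d2 : \dim L2 = 2%N.
  by rewrite /L2 EL2 //; apply: dim_join_neq; apply: nondegenerate_col.
apply: (lines_meet_uniq d1 d2).
- by case: (laplace_plus_sub (i + 1) (j + 1) nM).
- by rewrite /L2 EL2 // addvSr.
- by rewrite /L1 e1 e2; case: (laplace_plus_sub (i + 1) (j + 1) nM').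
- by rewrite /L2 eN eL EL2 // addvSr.
(* [N i (j + 1)] also lies on [L1], so equal lines would contain three vertices of a face of [N]. *)
move=> L12; case: (nN) => _ _ /(_ i j) [_ _ _ s4].
apply: (span_plane_not_line s4 d1).
- by rewrite L12 addvSl.
- by case: (laplace_plus_sub i (j + 1) nM).
- by case: (laplace_plus_sub (i + 1) (j + 1) nM).
Qed.

Lemma koenigs_corner P P' i j : bs_koenigs P -> bs_koenigs P' ->
  (forall s t : nat, (s <= 2)%N -> (t <= 2)%N -> (s, t) != (2, 2)%N ->
     P (i + s%:Z) (j + t%:Z) = P' (i + s%:Z) (j + t%:Z)) ->
  laplace_plus P (i + 1) (j + 1) = laplace_plus P' (i + 1) (j + 1) ->
  P (i + 2) (j + 2) = P' (i + 2) (j + 2).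
Proof.
move=> [nP bP] [nP' bP'] eqP eL.
have e00 := eqP 0%N 0%N isT isT isT; have e01 := eqP 0%N 1%N isT isT isT.
have e02 := eqP 0%N 2%N isT isT isT; have e10 := eqP 1%N 0%N isT isT isT.
have e11 := eqP 1%N 1%N isT isT isT; have e12 := eqP 1%N 2%N isT isT isT.
have e20 := eqP 2%N 0%N isT isT isT; have e21 := eqP 2%N 1%N isT isT isT.
rewrite !addr0 in e00 e01 e02 e10 e20.
have a2 (x : int) : x + 2 = x + 1 + 1 by lia.
rewrite !a2 in e02 e12 e20 e21 *.
(* In the Kœnigs condition at (i + 1, j), both factors H and the factor K(i, j + 1) are fixed by the
   data. Only K(i + 1, j + 1) still involves the unknown corner. *)
have := bP (i + 1) j; have := bP' (i + 1) j; rewrite addrK.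
have -> : invH P (i + 1) j = invH P' (i + 1) j.
  by rewrite /invH /= addrK /laplace_plus e00 e01 e10 e11 e20 e21.
have -> : invH P (i + 1) (j + 1) = invH P' (i + 1) (j + 1).
  by rewrite /invH /= addrK eL /laplace_plus e11 e12 e01 e02.
have -> : invK P i (j + 1) = invK P' i (j + 1).
  by rewrite /invK /= addrK /laplace_minus e00 e01 e02 e10 e11 e12.
move=> ->; set k := invK P' i (j + 1) => E.
have k0 : k != 0.
  have [y0 y1 _ _] := laplace_minus_neq i (j + 1) nP'.
  have [_ _ d0 d1] := laplace_minus_neq i j nP'.
  have [sy _] := laplace_minus_sub i (j + 1) nP'.
  have [_ sd] := laplace_minus_sub i j nP'.
  rewrite /k /invK /= addrK; apply: cross_ratio_neq0 => //.
  exact: (nondegenerate_row nP').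
have {E} : invK P (i + 1) (j + 1) = invK P' (i + 1) (j + 1).
  by apply: (mulIf k0); rewrite -E.
rewrite /invK /= addrK.
have -> : laplace_minus P (i + 1) j = laplace_minus P' (i + 1) j.
  by rewrite /laplace_minus e10 e11 e20 e21.
have [y0 y1 y2 y3] := laplace_minus_neq (i + 1) (j + 1) nP.
have [z0 z1 z2 z3] := laplace_minus_neq (i + 1) (j + 1) nP'.
have [_ _ d0 d1] := laplace_minus_neq (i + 1) j nP'.
have [sy sY] := laplace_minus_sub (i + 1) (j + 1) nP.
have [sz sZ] := laplace_minus_sub (i + 1) (j + 1) nP'.
have [_ sd] := laplace_minus_sub (i + 1) j nP'.
rewrite ?(e11, e12, e21) in y0 y1 y2 sy sY *.
(* The other three points in K(i + 1, j + 1) are known, so equal values force equal points of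
   P_(-1). *)
move/cross_ratio_inj => eY.
have {}eY : laplace_minus P (i + 1) (j + 1) = laplace_minus P' (i + 1) (j + 1).
  by apply: eY => //; exact: (nondegenerate_row nP').
have [x0 x1 x2 x3] := laplace_plus_neq (i + 1) (j + 1) nP.
have [w0 w1 w2 w3] := laplace_plus_neq (i + 1) (j + 1) nP'.
have [_ sx] := laplace_plus_sub (i + 1) (j + 1) nP.
have [_ sw] := laplace_plus_sub (i + 1) (j + 1) nP'.
rewrite ?(e11, e12, e21, eL, eY) in x2 sx sY y2.
(* The corner [X] is on the line through [B] and the known point of P_1, and on the line through [C]
   and the known point of P_(-1). These lines differ because [B], [C] and [X'] span a plane. *)
set X := P (i + 1 + 1) (j + 1 + 1) in sx sY *.
set X' := P' (i + 1 + 1) (j + 1 + 1) in sw sZ *.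
set B := P' (i + 1 + 1) (j + 1) in x2 sx sw w2.
set C := P' (i + 1) (j + 1 + 1) in y2 sY sZ z2.
have nBX : B <> X by rewrite /B -e21; exact: (nondegenerate_col nP).
have nCX : C <> X by rewrite /C -e12; exact: (nondegenerate_row nP).
have nBX' : B <> X' by exact: (nondegenerate_col nP').
have nCX' : C <> X' by exact: (nondegenerate_row nP').
have E1 := join_exchange nBX x2 sx; have E2 := join_exchange nCX y2 sY.
have E1' := join_exchange nBX' w2 sw; have E2' := join_exchange nCX' z2 sZ.
have dB := dim_join_neq nBX'; have dC := dim_join_neq nCX'.
apply: (lines_meet_uniq dB dC); rewrite ?addvSr //.
- by rewrite -E1' E1 addvSr.
- by rewrite -E2' E2 addvSr.
move=> L12; case: (nP') => _ _ /(_ (i + 1) (j + 1)) [_ _ _ s4].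
apply: (span_plane_not_line s4 dB); first exact: addvSl.
- by rewrite L12 addvSl.
- exact: addvSr.
Qed.

Lemma corner P P' m i j : (2 <= m)%N ->
  degenerate_koenigs m P -> degenerate_koenigs m P' ->
  (forall s t : nat, (s <= m)%N -> (t <= m)%N -> (s, t) != (m, m) ->
     P (i + s%:Z) (j + t%:Z) = P' (i + s%:Z) (j + t%:Z)) ->
  lap_plus m P i j = lap_plus m P' i j ->
  P (i + m%:Z) (j + m%:Z) = P' (i + m%:Z) (j + m%:Z).
Proof.
move=> m2 [kP xP _ _ _] [kP' xP' _ _ _] eqP eL.
(* After d steps down, P_(m-d) is compared at the vertex whose square of dependence still ends at
   the unknown corner (i + m, j + m). *)
have chain d : (d < m)%N -> lap_plus (m - d) P (i + d%:Z) (j + d%:Z) =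
                           lap_plus (m - d) P' (i + d%:Z) (j + d%:Z).
  elim: d => [|d IHd] dm; first by rewrite subn0 !addr0.
  have {IHd} := IHd (ltnW dm); have [k Ek] : exists k, (m - d = k.+2)%N.
    by exists (m - d - 2)%N; lia.
  have -> : (m - d.+1 = k.+1)%N by lia.
  rewrite Ek /lap_plus !iterS -!/(lap_plus _ _) => eLL.
  have eS (x : int) : x + d.+1%:Z = x + d%:Z + 1 by lia.
  rewrite !eS; apply: laplace_plus_corner.
  - by apply: xP; lia.
  - by apply: xP'; lia.
  - by apply: (xP k.+1); lia.
  - by apply: (xP' k.+1); lia.
  (* Relative to (i, j), the squares of the three known points end at (m - 1, m - 1), (m - 1, m) and
     (m, m - 1), so they avoid the unknown corner. *)
  - apply: lap_plus_ext => s t sk tk; rewrite -!eS -!addrA -!PoszD.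
    by apply: eqP; rewrite ?xpair_eqE; lia.
  - apply: lap_plus_ext => s t sk tk; rewrite -!eS.
    have -> : j + d.+1%:Z + 1 + t%:Z = j + (d + 2 + t)%N%:Z by lia.
    rewrite -!addrA -!PoszD.
    by apply: eqP; rewrite ?xpair_eqE; lia.
  - apply: (@lap_plus_ext _ _ k.+1) => s t sk tk; rewrite -!eS -!addrA -!PoszD.
    by apply: eqP; rewrite ?xpair_eqE; lia.
  - exact: eLL.
(* The descent ends with P_1 on the last face. The 3 by 3 square for the Kœnigs step then starts at
   (i + m - 2, j + m - 2). *)
have := chain (m - 1)%N; have -> : (m - (m - 1) = 1)%N by lia.
move=> /(_ ltac:(lia)) e1.
have em (x : int) : x + m%:Z = x + (m - 2)%N%:Z + 2 by lia.
rewrite !em; apply: koenigs_corner => // [s t s2 t2 st|].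
  rewrite -!addrA -!PoszD.
  by apply: eqP; clear -m2 s2 t2 st; rewrite ?xpair_eqE in st *; lia.
have em1 (x : int) : x + (m - 2)%N%:Z + 1 = x + (m - 1)%N%:Z by lia.
by rewrite !em1.
Qed.

(* Laplace degeneracy transports the value of P_m from the known square with
   lower left corner (i0, j0) to every square of the same m + 1 rows. *)
Lemma row_right P P' m i0 j0 : (2 <= m)%N ->
  degenerate_koenigs m P -> degenerate_koenigs m P' ->
  (forall i (t : nat), (t < m)%N -> P i (j0 + t%:Z) = P' i (j0 + t%:Z)) ->
  (forall s : nat, (s <= m)%N ->
     P (i0 + s%:Z) (j0 + m%:Z) = P' (i0 + s%:Z) (j0 + m%:Z)) ->
  forall r : nat, P (i0 + r%:Z) (j0 + m%:Z) = P' (i0 + r%:Z) (j0 + m%:Z).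
Proof.
move=> m2 kP kP' low start; elim/ltn_ind => r IHr.
have [/start //|mr] := leqP r m.
have -> : i0 + r%:Z = i0 + (r - m)%N%:Z + m%:Z by lia.
apply: corner => // [s t sm tm st|].
  have [tm'|tm'] := ltnP t m; first exact: low.
  have -> : t = m by lia.
  rewrite -addrA -PoszD; apply: IHr; rewrite xpair_eqE in st; lia.
case: kP kP' => _ _ _ dP _ [_ _ _ dP' _].
rewrite (dP _ _ i0) (dP' _ _ i0); apply: lap_plus_ext => s t sm tm.
have [tm'|tm'] := ltnP t m; first exact: low.
have -> : t = m by lia.
exact: start.
Qed.

Lemma row_agree P P' m i0 j0 : (2 <= m)%N ->
  degenerate_koenigs m P -> degenerate_koenigs m P' ->
  (forall i (t : nat), (t < m)%N -> P i (j0 + t%:Z) = P' i (j0 + t%:Z)) ->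
  (forall s : nat, (s <= m)%N ->
     P (i0 + s%:Z) (j0 + m%:Z) = P' (i0 + s%:Z) (j0 + m%:Z)) ->
  forall i, P i (j0 + m%:Z) = P' i (j0 + m%:Z).
Proof.
move=> m2 kP kP' low start i.
have [ii0|ii0] := lerP i0 i.
  have -> : i = i0 + `|i - i0|%N%:Z by lia.
  exact: row_right.
(* This reflection preserves the window from i0 to i0 + m and turns leftward propagation into
   rightward. *)
pose c : int := i0 + i0 + m%:Z.
have := @row_right (reflect_net c P) (reflect_net c P') m i0 j0 m2
  (degenerate_koenigs_reflect c kP) (degenerate_koenigs_reflect c kP').
rewrite /reflect_net => /(_ (fun i t => low (c - i) t)) H.
have {}H := H _ `|(c - i - i0)%R|%N.
have e : c - (i0 + `|(c - i - i0)%R|%N%:Z) = i by rewrite /c; lia.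
rewrite e in H; apply: H => s sm.
have -> : c - (i0 + s%:Z) = i0 + (m - s)%N%:Z by rewrite /c; lia.
by apply: start; lia.
Qed.

Lemma rows_agree_down P P' m i0 j0 : (2 <= m)%N ->
  degenerate_koenigs m P -> degenerate_koenigs m P' ->
  (forall i (t : nat), (t < m)%N -> P i (j0 + 1 + t%:Z) = P' i (j0 + 1 + t%:Z)) ->
  (forall s : nat, (s <= m)%N -> P (i0 + s%:Z) j0 = P' (i0 + s%:Z) j0) ->
  forall i, P i j0 = P' i j0.
Proof.
move=> m2 kP kP' low start i.
(* The reflection j to c - j swaps rows j0 and j0 + m. It is obtained by conjugating [reflect_net]
   with transposition. *)
pose c : int := j0 + m%:Z + j0.
pose refl (Q : net R n) := transpose_net (reflect_net c (transpose_net Q)).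
have kr Q : degenerate_koenigs m Q -> degenerate_koenigs m (refl Q).
  move/degenerate_koenigs_transpose/(degenerate_koenigs_reflect c).
  exact: degenerate_koenigs_transpose.
have := @row_agree (refl P) (refl P') m i0 j0 m2 (kr _ kP) (kr _ kP').
rewrite /refl /transpose_net /reflect_net.
have -> : c - (j0 + m%:Z) = j0 by rewrite /c; lia.
apply=> // x t tm.
have -> : c - (j0 + t%:Z) = j0 + 1 + (m - t.+1)%N%:Z by rewrite /c; lia.
by apply: low; lia.
Qed.

Lemma degenerate_koenigs_uniq P P' m : (2 <= m)%N ->
  degenerate_koenigs m P -> degenerate_koenigs m P' ->
  (forall i j, initial_set m i j -> P i j = P' i j) ->
  forall i j, P i j = P' i j.
Proof.
move=> m2 kP kP' init.
(* The starting window (0, m), ..., (m, m) lies in the initial set thanks to its extra point (m,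
   m). *)
have rowm i : P i m%:Z = P' i m%:Z.
  rewrite -[m%:Z]add0r; apply: (@row_agree _ _ _ 0) => // [x t tm|s sm].
    by apply: init; rewrite /initial_set !inE; lia.
  by apply: init; rewrite /initial_set !inE; lia.
have rows i (t : nat) : (t <= m)%N -> P i t%:Z = P' i t%:Z.
  rewrite leq_eqVlt => /orP[/eqP -> //|tm].
  by apply: init; rewrite /initial_set !inE; lia.
(* The window for column m comes from the rows just obtained. Columns 0 to m then supply a starting
   window for every further row. *)
have colm j : P m%:Z j = P' m%:Z j.
  rewrite -[m%:Z]add0r.
  apply: (@row_agree (transpose_net P) (transpose_net P') m 0 0) => //.
  - exact: degenerate_koenigs_transpose.
  - exact: degenerate_koenigs_transpose.
  - by move=> x t tm; apply: init; rewrite /initial_set !inE; lia.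
  - by move=> s sm; rewrite /transpose_net add0r; apply: rows.
have cols j (s : nat) : (s <= m)%N -> P s%:Z j = P' s%:Z j.
  rewrite leq_eqVlt => /orP[/eqP -> //|tm].
  by apply: init; rewrite /initial_set !inE; lia.
have up (t : nat) i : P i t%:Z = P' i t%:Z.
  elim/ltn_ind: t i => t IHt i; have [/rows //|mt] := leqP t m.
  have -> : t%:Z = (t - m)%N%:Z + m%:Z by lia.
  apply: (@row_agree _ _ _ 0) => // [x s sm|s sm].
    by rewrite -PoszD; apply: IHt; lia.
  by rewrite add0r; apply: cols.
have down (t : nat) i : P i (m%:Z - t%:Z) = P' i (m%:Z - t%:Z).
  elim/ltn_ind: t i => t IHt i; have [tm|mt] := leqP t m.
    have -> : m%:Z - t%:Z = (m - t)%N%:Z by lia.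
    exact: up.
  apply: (@rows_agree_down _ _ m 0) => // [x s sm|s sm].
    have -> : m%:Z - t%:Z + 1 + s%:Z = m%:Z - (t - s.+1)%N%:Z by lia.
    by apply: IHt; lia.
  by rewrite add0r; apply: cols.
move=> i [j|j]; first exact: up.
have -> : Negz j = m%:Z - (m + j.+1)%N%:Z by lia.
exact: down.
Qed.

End Uniqueness.

(** * Existence *)

Section Rising.
Variable R : realType.
Implicit Types (x : R) (a : nat).

Definition rising x a : R := \prod_(s < a) (x + s%:R).

Lemma rising_recr x a : rising x a.+1 = rising x a * (x + a%:R).
Proof. by rewrite /rising big_ord_recr. Qed.

Lemma rising_recl x a : rising x a.+1 = x * rising (x + 1) a.
Proof.
rewrite /rising big_ord_recl addr0; congr (_ * _); apply: eq_bigr => s _.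
by rewrite lift0 -natr1 -addrA [1 + _]addrC.
Qed.

Definition nonint x := forall z : int, x + z%:~R != 0.

Lemma nonint_addz x (z : int) : nonint x -> nonint (x + z%:~R).
Proof. by move=> nx y; rewrite -addrA -intrD; apply: nx. Qed.

Lemma nonint_addn x a : nonint x -> nonint (x + a%:R).
Proof. exact: (@nonint_addz x a). Qed.

Lemma nonint_subn x a : nonint x -> nonint (x - a%:R).
Proof. by move=> nx; have := nonint_addz (- a%:Z) nx; rewrite mulrNz. Qed.

Lemma nonint_opp x : nonint x -> nonint (- x).
Proof. by move=> nx z; rewrite -oppr_eq0 opprD opprK -mulrNz. Qed.

Lemma nonint_neq0 x : nonint x -> x != 0.
Proof. by move=> /(_ 0); rewrite addr0. Qed.

Lemma rising_neq0 x a : nonint x -> rising x a != 0.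
Proof. by move=> nx; apply/prodf_neq0 => s _; apply: (nx s). Qed.

Lemma invr_rising x a : nonint x ->
  [/\ (rising x a.+1)^-1 = (x + a.+1%:R) / rising x a.+2,
      (rising (x + 1) a.+1)^-1 = x / rising x a.+2
    & (rising (x + 1) a)^-1 = x * (x + a.+1%:R) / rising x a.+2].
Proof.
move=> nx; have x0 := nonint_neq0 nx.
have xa0 := nonint_neq0 (nonint_addn a.+1 nx).
have r0 := rising_neq0 a (nonint_addn 1 nx).
have r1 := rising_neq0 a.+1 nx.
split.
- by rewrite [rising x a.+2]rising_recr invfM mulrCA divff // mulr1.
- by rewrite [rising x a.+2]rising_recl invfM mulrA divff // mul1r.
- rewrite rising_recr rising_recl; move: (x + a.+1%:R) xa0 => c c0.
  by field; rewrite c0 r0 x0.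
Qed.

Lemma quadratic_eq0 (f0 f1 f2 : R) :
  (forall k : nat, (k < 3)%N -> f0 + f1 * k%:R + f2 * k%:R ^+ 2 = 0) ->
  [/\ f0 = 0, f1 = 0 & f2 = 0].
Proof.
by move=> H; have := H 0%N isT; have := H 1%N isT; have := H 2%N isT; split; lra.
Qed.

End Rising.

(** * The explicit nets and their Laplace sequences *)

Section Example.
Variables (R : realType) (n : nat) (n2 : (2 <= n)%N).
Local Notation V := 'rV[R]_n.+1.
Implicit Types (p q : R) (a b : nat).

Lemma dim_sum3 (u v w : V) :
  (forall x y z : R, x *: u + y *: v + z *: w = 0 -> [/\ x = 0, y = 0 & z = 0]) ->
  \dim (<[u]> + <[v]> + <[w]>)%VS = 3%N.
Proof.
move=> H; have : free [tuple u; v; w].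
  apply/freeP => k; rewrite !big_ord_recl big_ord0 /= addr0 addrA => /H[k0 k1 k2].
  by case=> [[|[|[|//]]] i3]; [rewrite -[RHS]k0 | rewrite -[RHS]k1 | rewrite -[RHS]k2];
    congr (k _); apply/val_inj.
by rewrite /free /= !span_cons span_nil addv0 addvA => /eqP.
Qed.

Lemma unit_point_proof : \dim <[const_mx 1 : V]>%VS == 1%N.
Proof.
rewrite dim_vline; suff -> : (const_mx 1 : V) != 0 by [].
by apply/eqP => /rowP /(_ 0) /eqP; rewrite !mxE oner_eq0.
Qed.

(** The default point, spanned by the all-ones vector, is taken only at v = 0. *)
Definition point_of (v : V) : RP R n := insubd (ProjPoint unit_point_proof) <[v]>%VS.

Lemma point_ofE v : v != 0 -> point_of v = <[v]>%VS :> {vspace V}.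
Proof. by move=> v0; rewrite [LHS]insubdK // unfold_in dim_vline v0. Qed.

Definition evec a b p q : V :=
  \row_k (rising (p - k%:R) a * rising (q - k%:R) b)^-1.

Lemma evec_neq0 a b p q : nonint p -> nonint q -> evec a b p q != 0.
Proof.
move=> np nq; apply/eqP => /rowP /(_ 0) /eqP; rewrite !mxE invr_eq0 mulf_eq0.
by rewrite !(negbTE (rising_neq0 _ _)) //; apply: nonint_subn.
Qed.

Lemma evecC a b p q : evec a b p q = evec b a q p.
Proof. by apply/rowP => k; rewrite !mxE mulrC. Qed.

(** Dividing each coordinate by its own nonzero [w] turns linear relations between these vectors
    into polynomial identities in x and y. *)
Lemma evec_square a b p q (k : 'I_n.+1) (x := p - k%:R) (y := q - k%:R) :
  nonint p -> nonint q -> exists2 w : R, w != 0 &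
  [/\ evec a.+1 b.+1 p q 0 k = w * ((x + a.+1%:R) * (y + b.+1%:R)),
      evec a.+1 b.+1 (p + 1) q 0 k = w * (x * (y + b.+1%:R)),
      evec a.+1 b.+1 p (q + 1) 0 k = w * ((x + a.+1%:R) * y),
      evec a.+1 b.+1 (p + 1) (q + 1) 0 k = w * (x * y)
    & evec a b.+2 (p + 1) q 0 k = w * (x * (x + a.+1%:R))].
Proof.
move=> np nq; exists (rising x a.+2 * rising y b.+2)^-1.
  by rewrite invr_eq0 mulf_neq0 //; apply: rising_neq0; apply: nonint_subn.
have [x0 x1 x2] := @invr_rising _ x a (nonint_subn k np).
have [y0 y1 _] := @invr_rising _ y b (nonint_subn k nq).
rewrite /evec !mxE.
have -> : p + 1 - k%:R = x + 1 by rewrite /x; ring.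
have -> : q + 1 - k%:R = y + 1 by rewrite /y; ring.
by rewrite -/x -/y !invfM x0 x1 x2 y0 y1; split; ring.
Qed.

(** The left side is quadratic in t and vanishes at t = 0, 1, 2, which are coordinate indices since
    n is at least 2. Hence it vanishes identically and may be evaluated at any real t. *)
Lemma evec_square_rel a b p q (c00 c10 c01 c11 : R) : nonint p -> nonint q ->
  c00 *: evec a.+1 b.+1 p q + c10 *: evec a.+1 b.+1 (p + 1) q +
  c01 *: evec a.+1 b.+1 p (q + 1) + c11 *: evec a.+1 b.+1 (p + 1) (q + 1) = 0 ->
  forall t : R,
    c00 * ((p - t + a.+1%:R) * (q - t + b.+1%:R)) + c10 * ((p - t) * (q - t + b.+1%:R)) +
    c01 * ((p - t + a.+1%:R) * (q - t)) + c11 * ((p - t) * (q - t)) = 0.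
Proof.
move=> np nq rel.
pose f0 := c00 * ((p + a.+1%:R) * (q + b.+1%:R)) + c10 * (p * (q + b.+1%:R)) +
           c01 * ((p + a.+1%:R) * q) + c11 * (p * q).
pose f1 := - (c00 * (p + a.+1%:R + q + b.+1%:R) + c10 * (p + q + b.+1%:R) +
              c01 * (p + a.+1%:R + q) + c11 * (p + q)).
pose f2 := c00 + c10 + c01 + c11.
suff [z0 z1 z2] : [/\ f0 = 0, f1 = 0 & f2 = 0].
  move=> t; transitivity (f0 + f1 * t + f2 * t ^+ 2); first by rewrite /f0 /f1 /f2; ring.
  by rewrite z0 z1 z2 !mul0r !addr0.
apply: quadratic_eq0 => k k3; have kn : (k < n.+1)%N by lia.
have addE (u v : V) j : (u + v) 0 j = u 0 j + v 0 j by rewrite mxE.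
have scaleE (c : R) (v : V) j : (c *: v) 0 j = c * v 0 j by rewrite mxE.
have /rowP /(_ (Ordinal kn)) := rel; rewrite !addE !scaleE [RHS]mxE.
have [w w0 [-> -> -> -> _] H] := evec_square a b (Ordinal kn) np nq.
by apply: (mulfI w0); rewrite mulr0 -H /f0 /f1 /f2 /=; ring.
Qed.

(* With x = p - k, y = q - k and d = x - y, and a, b for a + 1, b + 1, the next
   three lemmas are the relations
   (b - a - d) x y = d (x + a) (y + b) - (d + a) x (y + b) + (b - d) (x + a) y,
   b x = d (y + b) + (b - d) y and b (x + a) = (d + a) (y + b) + (b - d - a) y. *)
Lemma evec_coplanar a b p q (d := p - q) :
  nonint p -> nonint q ->
  (b.+1%:R - a.+1%:R - d) *: evec a.+1 b.+1 (p + 1) (q + 1) =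
  d *: evec a.+1 b.+1 p q - (d + a.+1%:R) *: evec a.+1 b.+1 (p + 1) q
  + (b.+1%:R - d) *: evec a.+1 b.+1 p (q + 1).
Proof.
move=> np nq; apply/rowP => k.
have addE (u v : V) : (u + v) 0 k = u 0 k + v 0 k by rewrite mxE.
have oppE (v : V) : (- v) 0 k = - v 0 k by rewrite mxE.
have scaleE (c : R) (v : V) : (c *: v) 0 k = c * v 0 k by rewrite mxE.
rewrite !(addE, oppE, scaleE).
have [w _ [-> -> -> -> _]] := evec_square a b k np nq.
by rewrite /d; ring.
Qed.

Lemma evec_left a b p q (d := p - q) : nonint p -> nonint q ->
  evec a b.+2 (p + 1) q = (d / b.+1%:R) *: evec a.+1 b.+1 p q
    + ((b.+1%:R - d) / b.+1%:R) *: evec a.+1 b.+1 p (q + 1).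
Proof.
move=> np nq; apply/rowP => k.
have addE (u v : V) : (u + v) 0 k = u 0 k + v 0 k by rewrite mxE.
have scaleE (c : R) (v : V) : (c *: v) 0 k = c * v 0 k by rewrite mxE.
rewrite !(addE, scaleE).
have [w _ [-> _ -> _ ->]] := evec_square a b k np nq.
have b0 : b.+1%:R != 0 :> R by rewrite pnatr_eq0.
move: b.+1%:R b0 => c c0.
by rewrite /d; field.
Qed.

Lemma evec_right a b p q (d := p - q) : nonint p -> nonint q ->
  evec a b.+2 (p + 1) q = ((d + a.+1%:R) / b.+1%:R) *: evec a.+1 b.+1 (p + 1) q
    + ((b.+1%:R - d - a.+1%:R) / b.+1%:R) *: evec a.+1 b.+1 (p + 1) (q + 1).
Proof.
move=> np nq; apply/rowP => k.
have addE (u v : V) : (u + v) 0 k = u 0 k + v 0 k by rewrite mxE.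
have scaleE (c : R) (v : V) : (c *: v) 0 k = c * v 0 k by rewrite mxE.
rewrite !(addE, scaleE).
have [w _ [_ -> _ -> ->]] := evec_square a b k np nq.
have b0 : b.+1%:R != 0 :> R by rewrite pnatr_eq0.
move: b.+1%:R b0 => c c0.
by rewrite /d; field.
Qed.

Definition enet a b p q : net R n :=
  fun i j => point_of (evec a b (p + i%:~R) (q + j%:~R)).

Lemma enetE a b p q i j : nonint p -> nonint q ->
  enet a b p q i j = <[evec a b (p + i%:~R) (q + j%:~R)]>%VS :> {vspace V}.
Proof.
by move=> np nq; rewrite point_ofE // evec_neq0 //; apply: nonint_addz.
Qed.

Lemma enet_transpose a b p q : transpose_net (enet a b p q) = enet b a q p.
Proof. by apply/funext => i; apply/funext => j; rewrite /transpose_net /enet evecC. Qed.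

Lemma addz1 p (i : int) : p + (i + 1)%:~R = p + i%:~R + 1.
Proof. by rewrite intrD addrA. Qed.

Lemma nonint_sub_shift p q (i j : int) : nonint (p - q) ->
  nonint ((p + i%:~R) - (q + j%:~R)).
Proof.
move=> nd; have -> : p + i%:~R - (q + j%:~R) = p - q + (i - j)%:~R.
  by rewrite intrD mulrNz; ring.
exact: nonint_addz.
Qed.

(** With A = a + 1 and B = b + 1, the numbers p, p + A, q, q + B are distinct because p - q is not
    an integer. Suitable evaluations therefore isolate the coefficients one at a time. *)
Lemma evec_span_planes a b p q (d := p - q)
    (v00 := evec a.+1 b.+1 p q) (v10 := evec a.+1 b.+1 (p + 1) q)
    (v01 := evec a.+1 b.+1 p (q + 1)) (v11 := evec a.+1 b.+1 (p + 1) (q + 1)) :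
  nonint p -> nonint q -> nonint d ->
  [/\ \dim (<[v00]> + <[v10]> + <[v01]>)%VS = 3%N,
      \dim (<[v00]> + <[v10]> + <[v11]>)%VS = 3%N,
      \dim (<[v00]> + <[v01]> + <[v11]>)%VS = 3%N
    & \dim (<[v10]> + <[v01]> + <[v11]>)%VS = 3%N].
Proof.
move=> np nq nd.
have a0 : a.+1%:R != 0 :> R by rewrite pnatr_eq0.
have b0 : b.+1%:R != 0 :> R by rewrite pnatr_eq0.
have d0 := nonint_neq0 nd.
have da := nonint_neq0 (nonint_addn a.+1 nd).
have db := nonint_neq0 (nonint_subn b.+1 nd).
have dab := nonint_neq0 (nonint_subn b.+1 (nonint_addn a.+1 nd)).
have Q c00 c10 c01 c11 := @evec_square_rel a b p q c00 c10 c01 c11 np nq.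
rewrite -/v00 -/v10 -/v01 -/v11 in Q.
move: a.+1%:R b.+1%:R a0 b0 da db dab Q => A B a0 b0 da db dab Q.
have cancel (s s' t : R) : s != 0 -> s' != 0 -> t * (s * s') = 0 -> t = 0.
  move=> s0 s0' /eqP; rewrite !mulf_eq0 (negbTE s0) (negbTE s0') !orbF.
  by move/eqP.
(* Evaluate the relation at the roots t = p, p + A, q, q + B of the factors. *)
split; apply: dim_sum3 => u v w rel.
- have {}Q := Q u v w 0 ltac:(by rewrite scale0r addr0).
  have w0 : w = 0 by apply: (cancel _ _ _ b0 dab); have := Q (q + B); rewrite /d; lra.
  rewrite w0 in Q.
  have v0 : v = 0 by apply: (cancel _ _ _ a0 dab); have := Q (p + A); rewrite /d; lra.
  rewrite v0 in Q.
  by split=> //; apply: (cancel _ _ _ a0 db); have := Q p; rewrite /d; lra.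
- have {}Q := Q u v 0 w ltac:(by rewrite scale0r addr0).
  have w0 : w = 0 by apply: (cancel _ _ _ b0 db); have := Q (q + B); rewrite /d; lra.
  rewrite w0 in Q.
  have v0 : v = 0 by apply: (cancel _ _ _ a0 dab); have := Q (p + A); rewrite /d; lra.
  rewrite v0 in Q.
  by split=> //; apply: (cancel _ _ _ a0 db); have := Q p; rewrite /d; lra.
- have {}Q := Q u 0 v w ltac:(by rewrite scale0r addr0).
  have w0 : w = 0 by apply: (cancel _ _ _ a0 da); have := Q (p + A); rewrite /d; lra.
  rewrite w0 in Q.
  have u0 : u = 0 by apply: (cancel _ _ _ b0 da); have := Q q; rewrite /d; lra.
  rewrite u0 in Q.
  by split=> //; apply: (cancel _ _ _ b0 dab); have := Q (q + B); rewrite /d; lra.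
- have {}Q := Q 0 u v w ltac:(by rewrite scale0r add0r).
  have v0 : v = 0 by apply: (cancel _ _ _ a0 d0); have := Q p; rewrite /d; lra.
  rewrite v0 in Q.
  have u0 : u = 0 by apply: (cancel _ _ _ b0 d0); have := Q q; rewrite /d; lra.
  rewrite u0 in Q.
  by split=> //; apply: (cancel _ _ _ a0 da); have := Q (p + A); rewrite /d; lra.
Qed.

Lemma enet_nondegenerate a b p q : nonint p -> nonint q -> nonint (p - q) ->
  nondegenerate (enet a.+1 b.+1 p q).
Proof.
move=> np nq nd.
have spans i j := evec_span_planes a b (nonint_addz i np) (nonint_addz j nq)
  (nonint_sub_shift i j nd).
have planes i j : let P := enet a.+1 b.+1 p q in
    [/\ span_plane (P i j) (P (i + 1) j) (P i (j + 1)),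
        span_plane (P i j) (P (i + 1) j) (P (i + 1) (j + 1)),
        span_plane (P i j) (P i (j + 1)) (P (i + 1) (j + 1))
      & span_plane (P (i + 1) j) (P i (j + 1)) (P (i + 1) (j + 1))].
  by rewrite /= /span_plane !enetE // !addz1; apply: spans.
split=> [i j|i j|i j]; last exact: planes.
- have [s1 _ _ _] := planes i j.
  exists (enet a.+1 b.+1 p q i j + enet a.+1 b.+1 p q (i + 1)%R j
    + enet a.+1 b.+1 p q i (j + 1)%R)%VS.
  split=> //; split; rewrite ?addvSr //.
  + by rewrite -addvA addvSl.
  + by rewrite addvAC addvSr.
  rewrite !enetE // !addz1 -memvE.
  (* This is the coefficient of the fourth vertex in [evec_coplanar]. As it is nonzero, membership
     of that vertex may be tested after scaling by it. *)
  have d0 : b.+1%:R - a.+1%:R - (p + i%:~R - (q + j%:~R)) != 0.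
    rewrite -opprB oppr_eq0 opprB addrA.
    exact/nonint_neq0/nonint_subn/nonint_addn/nonint_sub_shift.
  rewrite -[_ \in _]/(false || _) -(negbTE d0) -rpredZeq.
  rewrite evec_coplanar; try exact: nonint_addz.
  have inL c (v : V) : c *: v \in <[v]>%VS by rewrite memvZ // memv_line.
  by rewrite -scaleNr !memv_add.
- have [s1 _ s3 _] := planes i j; split=> E; [move: s1 | move: s3];
    by move/dim_join; rewrite -E addvv dim_RP.
Qed.

Lemma enet_laplace a b p q : nonint p -> nonint q -> nonint (p - q) ->
  laplace_plus (enet a.+1 b.+1 p q) = enet a b.+2 (p + 1) q.
Proof.
move=> np nq nd; apply/funext => i; apply/funext => j.
have np1 : nonint (p + 1) := nonint_addn 1 np.
have inL c (v : V) : c *: v \in <[v]>%VS by rewrite memvZ // memv_line.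
have e1 : p + 1 + i%:~R = p + i%:~R + 1 by rewrite addrAC.
apply: laplace_plus_uniq; first exact: enet_nondegenerate.
  rewrite !enetE // !addz1 -memvE e1 evec_left; try exact: nonint_addz.
  by rewrite memv_add.
rewrite !enetE // !addz1 -memvE e1 evec_right; try exact: nonint_addz.
by rewrite memv_add.
Qed.

Lemma enet_lap_plus m k p q : (k <= m)%N -> nonint p -> nonint q -> nonint (p - q) ->
  lap_plus k (enet m m p q) = enet (m - k) (m + k) (p + k%:R) q.
Proof.
move=> + np nq nd; elim: k => [|k IHk] km; first by rewrite subn0 addn0 addr0.
rewrite /lap_plus iterS -/(lap_plus _ _) IHk; last exact: ltnW.
have -> : (m - k = (m - k.+1).+1)%N by lia.
have -> : (m + k = (m + k).-1.+1)%N by lia.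
rewrite enet_laplace //; first last.
- have -> : p + k%:R - q = p - q + k%:R by ring.
  exact: nonint_addn.
- exact: nonint_addn.
have -> : ((m + k).-1.+2 = m + k.+1)%N by lia.
by rewrite -addrA natr1.
Qed.

Lemma enet_lap_plus_exists m p q : nonint p -> nonint q -> nonint (p - q) ->
  lap_plus_exists m (enet m m p q).
Proof.
move=> np nq nd l lm; rewrite enet_lap_plus //; last exact: ltnW.
have -> : (m - l = (m - l).-1.+1)%N by lia.
have -> : (m + l = (m + l).-1.+1)%N by lia.
apply: enet_nondegenerate => //; first exact: nonint_addn.
have -> : p + l%:R - q = p - q + l%:R by ring.
exact: nonint_addn.
Qed.

(** After m steps the first rising factorial is an empty product, and with it the dependence on i
    disappears. *)
Lemma enet_degenerate m p q : nonint p -> nonint q -> nonint (p - q) ->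
  laplace_degenerate_plus m (enet m m p q).
Proof.
move=> np nq nd j i i'; rewrite enet_lap_plus // subnn /enet.
by congr point_of; apply/rowP => k; rewrite !mxE /rising !big_ord0.
Qed.

Definition cr_value (c d : R) : R := ((c - d) * (d - 1 + c)) / (d * (1 - d)).

Lemma enet_invH a p q i j : nonint p -> nonint q -> nonint (p - q) ->
  invH (enet a.+1 a.+1 p q) i j = cr_value a.+1%:R (p + i%:~R - (q + j%:~R)).
Proof.
move=> np nq nd; set c : R := a.+1%:R; set d := p + i%:~R - (q + j%:~R).
have c0 : c != 0 by rewrite pnatr_eq0.
have nP := enet_nondegenerate a a np nq nd.
have np1 : nonint (p + 1) := nonint_addn 1 np.
have d0 : d != 0 by apply/nonint_neq0/nonint_sub_shift.
have d1 : 1 - d != 0.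
  by rewrite -opprB oppr_eq0; apply/nonint_neq0/(@nonint_subn _ _ 1)/nonint_sub_shift.
rewrite /invH /= enet_laplace //.
(* The first pair of coordinates is that of P_1(i, j) by [evec_left]. The second is that of P_1(i -
   1, j) by [evec_right] on the face to the left, where d becomes d - 1. *)
rewrite (@cross_ratio_coords _ _ _ _ _ _ (evec a.+1 a.+1 (p + i%:~R) (q + j%:~R))
  (evec a.+1 a.+1 (p + i%:~R) (q + j%:~R + 1)) (d / c) ((c - d) / c)
  ((d - 1 + c) / c) ((1 - d) / c)).
- by rewrite /cr_value; field; rewrite d1 d0 nat1r pnatr_eq0.
- exact: (nondegenerate_col nP).
- by rewrite enetE.
- by rewrite enetE // addz1.
- rewrite -evec_left ?enetE //; try exact: nonint_addz.
  by rewrite addrAC.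
- rewrite enetE //.
  have -> : p + 1 + (i - 1)%:~R = p + (i - 1)%:~R + 1 by rewrite addrAC.
  rewrite evec_right; try exact: nonint_addz.
  have -> : p + (i - 1)%:~R + 1 = p + i%:~R by rewrite intrD addrA subrK.
  have -> : p + (i - 1)%:~R - (q + j%:~R) = d - 1 by rewrite /d intrD; ring.
  by congr <[_ *: _ + _ *: _]>%VS; rewrite -/c; ring.
Qed.

Lemma enet_bs_koenigs a p q : nonint p -> nonint q -> nonint (p - q) ->
  bs_koenigs (enet a.+1 a.+1 p q).
Proof.
move=> np nq nd; split=> [|i j]; first exact: enet_nondegenerate.
have nd' : nonint (q - p) by rewrite -opprB; apply: nonint_opp.
rewrite !invK_transpose enet_transpose !enet_invH //.
set c : R := a.+1%:R; set d := p + i%:~R - (q + j%:~R).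
have crS x : cr_value c (1 - x) = cr_value c x.
  by rewrite /cr_value; congr (_ / _); ring.
(* The factors H have arguments d and d - 1, the factors K have 1 - d and 1 - (d - 1). *)
have -> : p + i%:~R - (q + (j + 1)%:~R) = d - 1 by rewrite /d intrD; ring.
have -> : q + (j + 1)%:~R - (p + i%:~R) = 1 - d by rewrite /d intrD; ring.
have -> : q + (j + 1)%:~R - (p + (i - 1)%:~R) = 1 - (d - 1) by rewrite /d !intrD; ring.
by rewrite !crS.
Qed.

Lemma enet_degenerate_koenigs a p q : nonint p -> nonint q -> nonint (p - q) ->
  degenerate_koenigs a.+1 (enet a.+1 a.+1 p q).
Proof.
move=> np nq nd; have nd' : nonint (q - p) by rewrite -opprB; apply: nonint_opp.
split.
- exact: enet_bs_koenigs.
- exact: enet_lap_plus_exists.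
- move=> l la; rewrite -enet_transpose lap_minus_transpose.
  exact/nondegenerate_transpose/enet_lap_plus_exists.
- exact: enet_degenerate.
- by move=> i j j'; rewrite -enet_transpose lap_minus_transpose; apply: enet_degenerate.
Qed.

End Example.

(** * Admissible parameters and conclusion *)

Lemma nonint_third (R : realType) : nonint (3^-1 : R).
Proof.
move=> z; apply/eqP => E.
have : (1 + 3 * z)%:~R = 0 :> R.
  rewrite intrD intrM; apply: (mulfI (_ : 3^-1 != 0 :> R)); first by lra.
  by rewrite mulr0 -E; field.
by move/eqP; rewrite intr_eq0 => /eqP; lia.
Qed.

Lemma nonint_two_thirds (R : realType) : nonint (3^-1 - - 3^-1 : R).
Proof.
move=> z; apply/eqP => E.
have : (2 + 3 * z)%:~R = 0 :> R.
  rewrite intrD intrM; apply: (mulfI (_ : 3^-1 != 0 :> R)); first by lra.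
  by rewrite mulr0 -E; field.
by move/eqP; rewrite intr_eq0 => /eqP; lia.
Qed.

Theorem theorem7p5 (R : realType) (m n : nat) (hm : (2 <= m)%N) (hn : (2 <= n)%N) :
  (exists P : net R n,
     [/\ bs_koenigs P,
         lap_plus_exists m P, lap_minus_exists m P,
         laplace_degenerate_plus m P & laplace_degenerate_minus m P])
  /\
  (forall P P' : net R n,
     [/\ bs_koenigs P,
         lap_plus_exists m P, lap_minus_exists m P,
         laplace_degenerate_plus m P & laplace_degenerate_minus m P] ->
     [/\ bs_koenigs P',
         lap_plus_exists m P', lap_minus_exists m P',
         laplace_degenerate_plus m P' & laplace_degenerate_minus m P'] ->
     (forall i j : int, initial_set m i j -> P i j = P' i j) ->
     forall i j : int, P i j = P' i j).
Proof.
split; last by move=> P P' kP kP'; apply: degenerate_koenigs_uniq kP kP'.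
(* With p = 1/3 and q = -1/3 the difference is 2/3, so p, q and p - q all avoid the integers. *)
case: m hm => // a _; exists (enet n a.+1 a.+1 3^-1 (- 3^-1)).
apply: enet_degenerate_koenigs => //; first exact: nonint_third.
  exact/nonint_opp/nonint_third.
exact: nonint_two_thirds.
Qed.
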